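(* Let $m\geq 2$, let $F$ be a commutative field of characteristic two, and let $V_1,\dots,V_m$ be two-dimensional vector spaces over $F$. Then there exists in the projective space $\mathbb{P}\big(\bigotimes_{k=1}^m V_k\big)=\mathrm{PG}(2^m-1,F)$, the ambient space of the Segre variety $\mathcal{S}_{(m)}(F)$, a regular quadric $\mathcal{Q}(F)$ with the following properties: 1. The projective index of $\mathcal{Q}(F)$ is $2^{m-1}-1$. 2. $\mathcal{Q}(F)$ is invariant under the group of projective collineations (elements of $\mathrm{PGL}\big(\bigotimes_{k=1}^m V_k\big)$) stabilising the Segre variety $\mathcal{S}_{(m)}(F)$.
   Context: For a vector space $V$, $\mathbb{P}(V)$ denotes the projective space whose points are the one-dimensional subspaces of $V$. The Segre variety is the point set $\mathcal{S}_{(m)}(F)=\{F(a_1\otimes a_2\otimes\cdots\otimes a_m)\mid a_k\in V_k\setminus\{0\}\}$ in $\mathbb{P}\big(\bigotimes_{k=1}^m V_k\big)$. A quadric is the set of points $FX$ with $Q(X)=0$, where $Q$ is a quadratic form on $\bigotimes_{k=1}^m V_k$. It is regular if no non-zero vector $X$ in the radical of the polar form $(X,Y)\mapsto Q(X+Y)-Q(X)-Q(Y)$ satisfies $Q(X)=0$. The projective index of the quadric is the maximal projective dimension of a subspace contained in it (i.e. the Witt index of $Q$ minus one). *)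

(* Defs.v *)
From HB Require Import structures.
From mathcomp Require Import all_boot all_order all_algebra.
From mathcomp Require Import classical_sets.

Set Implicit Arguments.
Unset Strict Implicit.
Unset Printing Implicit Defensive.

Import GRing.Theory.
Local Open Scope ring_scope.
Local Open Scope classical_set_scope.

(* [dfwith a x] is the family [a] with its [k]-th entry replaced by [x : V k],
   so multilinearity is linearity in each argument, the others being fixed. *)
Definition multilinear (F : fieldType) (m : nat) (V : 'I_m -> lmodType F)
    (U : lmodType F) (f : (forall k, V k) -> U) : Prop :=
  forall (a : forall k, V k) (k : 'I_m), linear (fun x : V k => f (dfwith a x)).

(* MathComp has no tensor product of abstract spaces: [T], together with
   [tens a] = a_1 (x) ... (x) a_m, is characterised by the universal property
   among all (possibly infinite-dimensional) vector spaces. *)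
Definition is_tensor_product (F : fieldType) (m : nat) (V : 'I_m -> vectType F)
    (T : vectType F) (tens : (forall k, V k) -> T) : Prop :=
  multilinear (V := fun k => V k) tens /\
  forall (U : lmodType F) (f : (forall k, V k) -> U),
    multilinear (V := fun k => V k) f ->
    exists! g : T -> U, linear g /\ forall a, g (tens a) = f a.

Definition proj_point (F : fieldType) (T : vectType F) : Type :=
  {P : {vspace T} | \dim P == 1%N}.

Definition projdim (F : fieldType) (T : vectType F) (U : {vspace T}) : int :=
  (\dim U)%:Z - 1.

(* Elements of PGL(T), as the maps on points which they induce. *)
Definition projective_collineation (F : fieldType) (T : vectType F)
    (phi : proj_point T -> proj_point T) : Prop :=
  exists g : 'End(T), lker g = 0%VS /\
    forall P : proj_point T, \val (phi P) = (g @: \val P)%VS.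

Definition stabilises (F : fieldType) (T : vectType F)
    (phi : proj_point T -> proj_point T) (S : set (proj_point T)) : Prop :=
  phi @` S = S.

Definition segre (F : fieldType) (m : nat) (V : 'I_m -> vectType F)
    (T : vectType F) (tens : (forall k, V k) -> T) : set (proj_point T) :=
  [set P | exists a : forall k, V k,
     (forall k, a k != 0) /\ \val P = <[tens a]>%VS].

Definition polar (F : fieldType) (T : vectType F) (Q : T -> F) (X Y : T) : F :=
  Q (X + Y) - Q X - Q Y.

Definition quadratic_form (F : fieldType) (T : vectType F) (Q : T -> F) : Prop :=
  (forall (c : F) (X : T), Q (c *: X) = c ^+ 2 * Q X) /\
  (forall Y : T, scalar (polar Q Y) /\ scalar (fun X => polar Q X Y)).

Definition regular (F : fieldType) (T : vectType F) (Q : T -> F) : Prop :=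
  forall X : T, X != 0 -> (forall Y : T, polar Q X Y = 0) -> Q X != 0.

Definition quadric (F : fieldType) (T : vectType F) (Q : T -> F) :
    set (proj_point T) :=
  [set P | exists X : T, X != 0 /\ \val P = <[X]>%VS /\ Q X = 0].

Definition contained (F : fieldType) (T : vectType F) (U : {vspace T})
    (S : set (proj_point T)) : Prop :=
  forall P : proj_point T, (\val P <= U)%VS -> S P.

(* Since [projdim 0 = -1], the index of a point-free quadric is -1. *)
Definition has_projective_index (F : fieldType) (T : vectType F)
    (S : set (proj_point T)) (d : int) : Prop :=
  (exists U : {vspace T}, contained U S /\ projdim U = d) /\
  (forall U : {vspace T}, contained U S -> (projdim U <= d)%R).

(* Main.v *)
Require Import Defs.
From HB Require Import structures.
From mathcomp Require Import classical_sets boolp.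
From mathcomp Require Import all_boot all_order all_algebra ring.

Set Implicit Arguments.
Unset Strict Implicit.
Unset Printing Implicit Defensive.

Import GRing.Theory.
Local Open Scope ring_scope.

(** Write a basis of each plane V_k as e_(k, false), e_(k, true).  The tensors
    E_I, the products over k of e_(k, I k) for I : 'I_m -> bool, form a basis of
    T; call x_I the coordinates and ~I the pointwise complement.  The quadric is
    the hyperbolic one that pairs each E_I with E_(~I): Q is the sum of
    x_I x_(~I) over one I from each pair {I, ~I}.

    Its polar form is B(X, Y) = sum_I x_I(X) x_(~I)(Y), which is nondegenerate,
    so Q is regular ([quad_regular]).  The E_I with I k0 = false span a totally
    singular subspace of dimension 2^(m-1) ([quad_singular_half]), and a totally
    singular subspace is totally isotropic for B, so none is larger
    ([quad_singular_le]).

    In characteristic two B is the tensor product of the determinants of the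
    factors: B(a_1 (x) ... (x) a_m, b_1 (x) ... (x) b_m) is the product of the
    det(a_k, b_k) ([bilin_tens]), and Q vanishes on every pure tensor
    ([quad_tens]).  These two facts tie Q to the Segre variety.

    For the invariance the full stabiliser of the Segre variety is not computed.
    Let g be a linear bijection that maps pure tensors to pure tensors.  The sum
    of two nonzero pure tensors is pure only if their factors are proportional in
    all slots but at most one ([pure_sum]); hence g does not increase the number
    of slots in which two pure tensors differ ([hdist_collineation]).  Therefore
    B(g a, g b) = 0 as soon as the pure tensors a and b share a factor, which
    says that the multilinear form B(g a, g b) is alternating in each pair
    (a_k, b_k), so it is a multiple mu of the product of the determinants:
    B(gX, gY) = mu B(X, Y) ([bilin_collineation]).  Then Q o g and mu Q are
    quadratic forms with the same polar form that both vanish on the spanning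
    set of pure tensors, hence are equal, and mu is nonzero because B is. *)

(** * Families and linear maps *)

Lemma dfwith_id (m : nat) (V : 'I_m -> Type) (a : forall k, V k) (k : 'I_m) :
  dfwith a (a k) = a.
Proof.
by apply: functional_extensionality_dep => j; case: dfwithP.
Qed.

Lemma ffun_neq_ex (A : finType) (W : eqType) (f g : {ffun A -> W}) :
  f != g -> exists a, f a != g a.
Proof.
move=> fg; apply/existsP; apply: contra_neqT fg; rewrite negb_exists => /forallP fg.
by apply/ffunP => a; apply/eqP; rewrite -[_ == _]negbK.
Qed.

(** The predicate [linear] on bare functions gives access to the theory of
    linear maps only through the bundled structure. *)
Lemma linear_bundle (F : fieldType) (U W : lmodType F) (f : U -> W) :
  linear f -> exists h : {linear U -> W}, h =1 f.
Proof.
move=> lf; pose L := GRing.isLinear.Build _ _ _ _ f lf.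
pose h : {linear U -> W} := HB.pack f L.
by exists h.
Qed.

Lemma linear_mapD (F : fieldType) (U W : lmodType F) (f : U -> W) u v :
  linear f -> f (u + v) = f u + f v.
Proof. by case/linear_bundle=> h hE; rewrite -!hE linearD. Qed.

Lemma linear_mapZ (F : fieldType) (U W : lmodType F) (f : U -> W) c v :
  linear f -> f (c *: v) = c *: f v.
Proof. by case/linear_bundle=> h hE; rewrite -!hE linearZ. Qed.

(** * A vector plane and its determinant *)

Section Plane.
Variables (F : fieldType) (W : vectType F).
Hypothesis W2 : \dim {: W} = 2%N.

Definition bvec (b : bool) : W := (vbasis {: W})`_b.
Definition bcrd (b : bool) (v : W) : F :=
  coord (vbasis {: W}) (cast_ord (esym W2) (inord b)) v.

Lemma bcrd_is_linear b : scalar (bcrd b).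
Proof. by move=> a u v; rewrite /bcrd linearP. Qed.
HB.instance Definition _ b :=
  GRing.isLinear.Build F W F^o *:%R (bcrd b) (bcrd_is_linear b).

Lemma bcrd_bvec b b' : bcrd b (bvec b') = (b == b')%:R.
Proof.
rewrite /bcrd /bvec.
have -> : (b' : nat) = cast_ord (esym W2) (inord b') :> nat.
  by rewrite /= inordK //; case: b'.
rewrite coord_free ?(basis_free (vbasisP _)) //.
by rewrite -val_eqE /= !inordK; case: b; case: b'.
Qed.

Lemma bcrdE v : v = bcrd false v *: bvec false + bcrd true v *: bvec true.
Proof.
rewrite {1}(coord_vbasis (memvf v)).
rewrite (reindex (cast_ord (esym W2))) /=; last first.
  by exists (cast_ord W2) => i _; rewrite ?cast_ordKV ?cast_ordK.
rewrite !big_ord_recl big_ord0 addr0 /bcrd /bvec /=.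
have o0 : inord false = ord0 :> 'I_2 by apply/val_inj; rewrite /= inordK.
have o1 : inord true = lift ord0 ord0 :> 'I_2 by apply/val_inj; rewrite /= inordK.
by rewrite o0 o1.
Qed.

Definition pdet (u v : W) : F :=
  bcrd false u * bcrd true v - bcrd true u * bcrd false v.

Lemma pdetC u v : pdet u v = - pdet v u.
Proof. by rewrite /pdet; ring. Qed.

Lemma pdetvv u : pdet u u = 0.
Proof. by rewrite /pdet; ring. Qed.

Lemma bvec_neq0 b : bvec b != 0.
Proof.
apply/eqP=> e0; have := bcrd_bvec b b.
by rewrite e0 linear0 eqxx => /esym/eqP; rewrite oner_eq0.
Qed.

Lemma bvecD_neq0 : bvec false + bvec true != 0.
Proof.
apply/eqP=> e0; have := congr1 (bcrd true) e0.
by rewrite linearD linear0 /= !bcrd_bvec add0r => /eqP; rewrite oner_eq0.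
Qed.

(** Proportionality is transitive through a nonzero vector, by the Pluecker
    relation det(u, w) v = det(u, v) w + det(v, w) u. *)
Lemma pdet_trans v u w : v != 0 -> pdet u v = 0 -> pdet v w = 0 -> pdet u w = 0.
Proof.
move=> v0 uv vw; apply/eqP; apply: contraNT v0 => uw.
have vE b : bcrd b v = 0.
  apply: (mulfI uw); rewrite mulr0.
  have -> : pdet u w * bcrd b v = pdet u v * bcrd b w + pdet v w * bcrd b u.
    by rewrite /pdet; case: b; ring.
  by rewrite uv vw !mul0r addr0.
by rewrite (bcrdE v) !vE !scale0r addr0.
Qed.

(** A plane is not the union of two lines, even over the field with two
    elements: if neither p nor q works for both vectors, then p + q does. *)
Lemma pdet_neq0_ex u v : u != 0 -> v != 0 ->
  exists p, (pdet p u != 0) && (pdet p v != 0).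
Proof.
have ex w : w != 0 -> exists p, pdet p w != 0.
  move=> w0.
  have d0 : pdet (bvec false) w = bcrd true w.
    by rewrite /pdet !bcrd_bvec mul1r mul0r subr0.
  have d1 : pdet (bvec true) w = - bcrd false w.
    by rewrite /pdet !bcrd_bvec mul1r mul0r sub0r.
  case: (eqVneq (bcrd true w) 0) => [t0|t1]; last by exists (bvec false); rewrite d0.
  exists (bvec true); rewrite d1 oppr_eq0; apply: contraNneq w0 => f0.
  by rewrite (bcrdE w) t0 f0 !scale0r addr0.
move=> u0 v0; have [p pu] := ex u u0; have [q qv] := ex v v0.
case: (eqVneq (pdet p v) 0) => [pv|pv]; last by exists p; rewrite pu pv.
case: (eqVneq (pdet q u) 0) => [qu|qu]; last by exists q; rewrite qu qv.
exists (p + q); rewrite /pdet !linearD /=.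
have D w : (bcrd false p + bcrd false q) * bcrd true w -
    (bcrd true p + bcrd true q) * bcrd false w = pdet p w + pdet q w.
  by rewrite /pdet; ring.
by rewrite !D pv qu add0r addr0 pu.
Qed.

End Plane.

(** * Multilinear maps and coordinates on the tensor product *)

Section Families.
Variables (m : nat) (F : fieldType) (V : 'I_m -> vectType F).
Hypothesis hV : forall k, \dim {: V k} = 2%N.

Local Notation idx := {ffun 'I_m -> bool}.
Local Notation family := (forall k, V k).

Definition bfam (I : idx) : family := fun k => bvec (V k) (I k).

Lemma multilinear_comp (U W : lmodType F) (f : family -> U) (g : U -> W) :
  linear g -> multilinear (V := fun k => V k) f ->
  multilinear (V := fun k => V k) (g \o f).
Proof. by move=> lg mf a k c u v /=; rewrite mf lg. Qed.

Lemma multilinearD (U : lmodType F) (f : family -> U) a k (u v : V k) :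
  multilinear (V := fun k => V k) f ->
  f (dfwith a (u + v)) = f (dfwith a u) + f (dfwith a v).
Proof. by move=> mf; exact: (linear_mapD _ _ (mf a k)). Qed.

Lemma multilinearZ (U : lmodType F) (f : family -> U) a k c :
  multilinear (V := fun k => V k) f -> f (dfwith a (c *: a k)) = c *: f a.
Proof. by move=> mf; rewrite (linear_mapZ _ _ (mf a k)) dfwith_id. Qed.

Lemma multilinear_eq0 (U : lmodType F) (f : family -> U) a k :
  multilinear (V := fun k => V k) f -> a k = 0 -> f a = 0.
Proof.
move=> mf ak; rewrite -(dfwith_id a k) ak -(scale0r (a k)).
by rewrite multilinearZ // scale0r.
Qed.

(** The slots are expanded in the basis one at a time: in the induction the
    slots from n on already hold basis vectors. *)
Lemma multilinear_ext (U : lmodType F) (f g : family -> U) :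
  multilinear (V := fun k => V k) f -> multilinear (V := fun k => V k) g ->
  (forall I, f (bfam I) = g (bfam I)) -> f =1 g.
Proof.
move=> mf mg fg a.
suff: forall n a, (forall k : 'I_m, (n <= k)%N ->
    (a k == bvec (V k) true) || (a k == bvec (V k) false)) -> f a = g a.
  by move/(_ m a); apply=> k; rewrite leqNgt ltn_ord.
elim=> [|n IHn] {}a ha.
  have -> : a = bfam [ffun k => a k == bvec (V k) true].
    apply: functional_extensionality_dep => k; rewrite /bfam ffunE.
    by case: eqP (ha k (leq0n k)) => [-> //|_ /eqP].
  exact: fg.
case: (ltnP n m) => [nm|mn]; last first.
  apply: IHn => k nk; have := leq_trans (ltn_ord k) (leq_trans mn nk).
  by rewrite ltnn.
pose k := Ordinal nm.
have step b : f (dfwith a (bvec (V k) b)) = g (dfwith a (bvec (V k) b)).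
  apply: IHn => j; case: dfwithP => [_|{}j kj nj]; first by case: b; rewrite eqxx ?orbT.
  apply: ha; rewrite ltn_neqAle nj andbT.
  by apply: contra_neq kj => nj'; apply/val_inj.
rewrite -(dfwith_id a k) (bcrdE (hV k) (a k)) mf mg /=.
by rewrite !(linear_mapZ _ _ (mf _ _)) !(linear_mapZ _ _ (mg _ _)) !step.
Qed.

Definition coordprod (I : idx) (a : family) : F := \prod_k bcrd (hV k) (I k) (a k).

Lemma prod_dfwith (G : forall k, V k -> F) (a : family) k (u : V k) :
  \prod_j G j (dfwith a u j) = G k u * \prod_(j | j != k) G j (a j).
Proof.
rewrite (bigD1 k) //= dfwith_in; congr (_ * _).
by apply: eq_bigr => j jk; rewrite dfwith_out // eq_sym.
Qed.

Lemma coordprod_multilinear I :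
  multilinear (V := fun k => V k) (coordprod I : family -> F^o).
Proof.
move=> a k c u v /=.
rewrite /coordprod !(prod_dfwith (fun k => bcrd (hV k) (I k))) bcrd_is_linear.
by rewrite mulrDl -mulrA.
Qed.

Lemma coordprod_bfam I J : coordprod I (bfam J) = (I == J)%:R.
Proof.
rewrite /coordprod; under eq_bigr do rewrite bcrd_bvec.
have [->|neq] := eqVneq I J; first by rewrite big1 // => k _; rewrite eqxx.
have [k kIJ] := ffun_neq_ex neq.
by rewrite (bigD1 k) //= (negbTE kIJ) mul0r.
Qed.

Variables (T : vectType F) (tens : family -> T).
Hypothesis tensP : is_tensor_product tens.

(** The coordinate x_I exists by the universal property.  The map
    X |-> sum_I x_I(X) E_I is linear and fixes the pure tensors, so by the
    uniqueness part it is the identity. *)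
Lemma tensor_coordinates :
  exists x : idx -> {linear T -> F^o},
    (forall I a, x I (tens a) = coordprod I a) /\
    (forall X, X = \sum_I x I X *: tens (bfam I)).
Proof.
have [mt univ] := tensP.
have ex I : exists h : {linear T -> F^o}, forall a, h (tens a) = coordprod I a.
  have [g [[lg gE] _]] := univ F^o _ (coordprod_multilinear I).
  have [h hE] := linear_bundle lg.
  by exists h => a; rewrite hE gE.
have [x xE] := choice ex; exists x; split=> // X.
have [g0 [_ g0U]] := univ _ _ mt.
pose r X := \sum_I x I X *: tens (bfam I).
have lr : linear r.
  move=> c u v; rewrite /r scaler_sumr -big_split /=; apply: eq_bigr => I _.
  by rewrite linearP scalerDl scalerA.
have rtens : r \o tens =1 tens.
  apply: multilinear_ext => //; first exact: multilinear_comp.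
  move=> I /=; rewrite /r (bigD1 I) //= xE coordprod_bfam eqxx scale1r.
  rewrite big1 ?addr0 //.
  by move=> J JI; rewrite xE coordprod_bfam (negbTE JI) scale0r.
have e1 : g0 = id by apply: g0U; split=> // c u v.
have e2 : g0 = r by apply: g0U.
by rewrite -[X in X = _]/(id X) -e1 e2.
Qed.

End Families.

(** * The hyperbolic form and its totally singular subspaces *)

Section Form.
Variables (m : nat) (F : fieldType) (V : 'I_m -> vectType F).
Hypothesis hm : (2 <= m)%N.
Hypothesis F2 : 2%N \in [pchar F].
Hypothesis hV : forall k, \dim {: V k} = 2%N.

Local Notation idx := {ffun 'I_m -> bool}.
Local Notation family := (forall k, V k).

Variables (T : vectType F) (tens : family -> T).
Hypothesis tens_ml : multilinear (V := fun k => V k) tens.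
Variable x : idx -> {linear T -> F^o}.
Hypothesis xE : forall I a, x I (tens a) = coordprod hV I a.
Hypothesis xD : forall X, X = \sum_I x I X *: tens (bfam V I).

Local Notation det k := (pdet (hV k)).
Local Notation E I := (tens (bfam V I)).

Definition compl (I : idx) : idx := [ffun k => ~~ I k].

Lemma complK : involutive compl.
Proof. by move=> I; apply/ffunP => k; rewrite !ffunE negbK. Qed.

Lemma coord_basis I J : x I (E J) = (I == J)%:R.
Proof. by rewrite xE coordprod_bfam. Qed.

Lemma coord_inj X Y : (forall I, x I X = x I Y) -> X = Y.
Proof. by move=> XY; rewrite (xD X) (xD Y); apply: eq_bigr => I _; rewrite XY. Qed.

Definition bilin (X Y : T) : F := \sum_I x I X * x (compl I) Y.

Lemma bilinC X Y : bilin X Y = bilin Y X.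
Proof.
rewrite /bilin (reindex_inj (inv_inj complK)) /=.
by apply: eq_bigr => I _; rewrite complK mulrC.
Qed.

Lemma bilin_linearr X : scalar (bilin X).
Proof.
move=> c u v; rewrite /bilin mulr_sumr -big_split /=; apply: eq_bigr => I _.
by rewrite linearP mulrDr mulrCA.
Qed.

Lemma bilin_linearl Y : scalar (bilin^~ Y).
Proof. by move=> c u v; rewrite !(bilinC _ Y) bilin_linearr. Qed.

Lemma bilinDr X Y Z : bilin X (Y + Z) = bilin X Y + bilin X Z.
Proof. exact: (@linear_mapD F T F^o (bilin X) _ _ (@bilin_linearr X)). Qed.

Lemma bilinDl X Y Z : bilin (X + Y) Z = bilin X Z + bilin Y Z.
Proof. by rewrite !(bilinC _ Z) bilinDr. Qed.

Lemma bilin0r X : bilin X 0 = 0.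
Proof.
have bZ := @linear_mapZ F T F^o (bilin X) 0 0 (@bilin_linearr X).
by rewrite -(scale0r 0) bZ scale0r.
Qed.

Lemma bilin_basis I X : bilin (E I) X = x (compl I) X.
Proof.
rewrite /bilin (bigD1 I) //= coord_basis eqxx mul1r big1 ?addr0 // => J JI.
by rewrite coord_basis (negbTE JI) mul0r.
Qed.

(** The sum over I of the products over k is the expanded product over k of
    a_(k,0) b_(k,1) + a_(k,1) b_(k,0), which is a determinant because -1 = 1. *)
Lemma bilin_tens a b : bilin (tens a) (tens b) = \prod_k det k (a k) (b k).
Proof.
pose G k b' := bcrd (hV k) b' (a k) * bcrd (hV k) (~~ b') (b k).
transitivity (\sum_(I : idx) \prod_k G k (I k)).
  apply: eq_bigr => I _; rewrite !xE /coordprod -big_split /=.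
  by apply: eq_bigr => k _; rewrite ffunE.
rewrite -bigA_distr_bigA /=; apply: eq_bigr => k _.
by rewrite big_bool /G /pdet /= oppr_pchar2 // addrC.
Qed.

Let k0 : 'I_m := Ordinal (ltnW hm).

(** The condition on slot k0 selects one index from each pair {I, ~I}. *)
Definition quad (X : T) : F := \sum_(I : idx | ~~ I k0) x I X * x (compl I) X.

(** The indices with I k0 = true give the same terms as their complements with
    the two arguments exchanged. *)
Lemma polar_quad X Y : polar quad X Y = bilin X Y.
Proof.
rewrite /bilin (bigID (fun I : idx => ~~ I k0)) /=.
rewrite [X in _ = _ + X](reindex_inj (inv_inj complK)) /=.
under [X in _ = _ + X]eq_bigl do rewrite ffunE negbK.
rewrite /polar /quad -!sumrB -big_split /=; apply: eq_bigr => I _.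
by rewrite complK !linearD /=; ring.
Qed.

Lemma quad_quadratic : quadratic_form quad.
Proof.
split=> [c X|Y].
  rewrite /quad mulr_sumr; apply: eq_bigr => I _.
  by rewrite !linearZ /= -!scalerAl -scalerAr scalerA.
have pE X : polar quad X = bilin X.
  by apply: functional_extensionality_dep => Z; apply: polar_quad.
rewrite pE; split; first exact: bilin_linearr.
by move=> c u v; rewrite !pE bilin_linearl.
Qed.

Lemma quad_regular : regular quad.
Proof.
move=> X X0 XY; case/eqP: X0; apply: coord_inj => I.
by rewrite linear0 -[I]complK -bilin_basis bilinC -polar_quad XY.
Qed.

Lemma card_half : #|[pred I : idx | ~~ I k0]| = (2 ^ m.-1)%N.
Proof.
have e : #|[pred I : idx | ~~ I k0]| = #|[predC [pred I : idx | ~~ I k0]]|.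
  rewrite -!sum1_card (reindex_inj (inv_inj complK)) /=.
  by apply: eq_bigl => I; rewrite !inE ffunE.
have := cardC [pred I : idx | ~~ I k0].
rewrite -e card_ffun card_bool card_ord -[in (2 ^ m)%N](prednK (ltnW hm)).
rewrite expnS mul2n addnn.
exact: double_inj.
Qed.

(** All 2^(m-1) terms equal the product of all coordinates of all factors, and
    2^(m-1) is even since m >= 2. *)
Lemma quad_tens a : quad (tens a) = 0.
Proof.
pose p := \prod_k (bcrd (hV k) false (a k) * bcrd (hV k) true (a k)).
rewrite /quad; transitivity (\sum_(I : idx | ~~ I k0) p).
  apply: eq_bigr => I _; rewrite !xE /coordprod -big_split /=.
  by apply: eq_bigr => k _; rewrite ffunE; case: (I k) => //=; rewrite mulrC.
rewrite (sumr_const [pred I : idx | ~~ I k0] p) card_half.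
by case: m hm => [|[|n]] // _; rewrite /= expnS mulrnA mulr2n addrr_pchar2 // mul0rn.
Qed.

Lemma free_basis (n : nat) (f : 'I_n -> idx) :
  injective f -> free [tuple E (f i) | i < n].
Proof.
move=> fI; apply/freeP => k k0E i.
have {}k0E : \sum_i k i *: E (f i) = 0.
  by rewrite -[RHS]k0E; apply: eq_bigr => j _; rewrite nth_mktuple.
have := congr1 (x (f i)) k0E; rewrite linear0 linear_sum (bigD1 i) //= big1 ?addr0.
  by rewrite linearZ /= coord_basis eqxx [LHS]mulr1.
move=> j ji; rewrite linearZ /= coord_basis (inj_eq fI) eq_sym.
by rewrite (negbTE ji) [LHS]mulr0.
Qed.

Lemma quad_singular_half :
  exists U : {vspace T}, \dim U = (2 ^ m.-1)%N /\ forall X, X \in U -> quad X = 0.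
Proof.
pose P := [pred I : idx | ~~ I k0].
pose f (i : 'I_#|P|) := enum_val i.
exists <<[tuple E (f i) | i < #|P|]>>%VS; split.
  by rewrite (eqP (free_basis (@enum_val_inj _ P))) size_tuple card_half.
move=> X /coord_span ->; rewrite /quad big1 // => I I0.
rewrite [x (compl I) _](_ : _ = 0) ?mulr0 // linear_sum big1 // => i _.
rewrite nth_mktuple linearZ /= coord_basis.
have fP : ~~ f i k0 by exact: enum_valP i.
case: eqP => [e|_]; last by rewrite [LHS]mulr0.
by move: fP; rewrite -e ffunE I0.
Qed.

(** If U is totally isotropic, the matrix of coordinates of a basis of U is
    annihilated by the transpose of the same matrix with its columns permuted by
    the complement; both have rank dim U, so 2 dim U <= 2^m. *)
Lemma quad_singular_le (U : {vspace T}) :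
  (forall X, X \in U -> quad X = 0) -> (\dim U <= 2 ^ m.-1)%N.
Proof.
move=> UQ.
have UB X Y : X \in U -> Y \in U -> bilin X Y = 0.
  by move=> XU YU; rewrite -polar_quad /polar !UQ ?rpredD // !subr0.
pose u (i : 'I_(\dim U)) := (vbasis U)`_i.
have uU i : u i \in U by rewrite vbasis_mem // mem_nth // size_tuple.
pose A (s : idx -> idx) : 'M[F]_(\dim U, #|{: idx}|) :=
  \matrix_(i, j) x (s (enum_val j)) (u i).
have rA s : bijective s -> \rank (A s) = \dim U.
  move=> [s' ss' s's]; apply/eqP; rewrite -[_ == _]/(row_free _) -kermx_eq0.
  apply/eqP/row_matrixP => l; rewrite row0; set w := row l _.
  have wA : w *m A s = 0 by rewrite -row_mul mulmx_ker row0.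
  have w0 : \sum_i w 0 i *: u i = 0.
    apply: coord_inj => I; rewrite linear0 linear_sum.
    have := congr1 (fun M : 'rV_ _ => M 0 (enum_rank (s' I))) wA.
    rewrite !mxE => e; rewrite -[RHS]e; apply: eq_bigr => i _.
    by rewrite linearZ /= [A s i _]mxE enum_rankK s's.
  apply/rowP => i; rewrite [RHS]mxE.
  by move/freeP: (basis_free (vbasisP U)) => /(_ (w 0) w0 i).
have AA : A id *m (A compl)^T = 0.
  apply/matrixP => i j; rewrite !mxE.
  rewrite -[RHS](UB (u i) (u j)) // /bilin.
  rewrite [RHS](reindex_onto enum_val enum_rank) => [|I _] /=; last by rewrite enum_rankK.
  by apply: eq_big => [k|k _]; rewrite ?enum_valK ?eqxx // !mxE.
have : (\dim U + \dim U <= #|{: idx}|)%N.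
  have := mulmx0_rank_max AA; rewrite mxrank_tr !rA //.
    by exists compl; exact: complK.
  by exists id.
rewrite card_ffun card_bool card_ord -[X in (2 ^ X)%N](prednK (ltnW hm)).
rewrite expnS mul2n addnn.
by rewrite leq_double.
Qed.

(** * Sums of pure tensors *)

Lemma tens_neq0P a : tens a != 0 -> forall k, a k != 0.
Proof. by move=> a0 k; apply: contra_neq a0; apply: multilinear_eq0. Qed.

(** The product of the functionals det(p_k, .) is B(tens p, .) on pure tensors;
    so p provides a functional on T that is nonzero at tens a and at tens b. *)
Lemma common_dual a b : (forall k, a k != 0) -> (forall k, b k != 0) ->
  exists p : family, forall k, (det k (p k) (a k) != 0) && (det k (p k) (b k) != 0).
Proof.
move=> a0 b0.
have ex k : exists p : V k, (det k p (a k) != 0) && (det k p (b k) != 0).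
  exact: pdet_neq0_ex.
by exists (fun k => xchoose (ex k)) => k; apply: (xchooseP (ex k)).
Qed.

Lemma tens_neq0 a : (forall k, a k != 0) -> tens a != 0.
Proof.
move=> a0; have [p pa] := common_dual a0 a0.
apply: contraTneq isT => ta.
have : bilin (tens p) (tens a) != 0.
  by rewrite bilin_tens; apply/prodf_neq0 => k _; case/andP: (pa k).
by rewrite ta bilin0r eqxx.
Qed.

Lemma bilin_dfwith2 p z i j (u : V i) (v : V j) : i != j ->
  bilin (tens (dfwith (dfwith p u) v)) (tens z) =
  det i u (z i) * (det j v (z j) *
    \prod_(k | (k != j) && (k != i)) det k (p k) (z k)).
Proof.
move=> ij; rewrite bilin_tens (bigD1 j) //= dfwith_in (bigD1 i) //=.
rewrite dfwith_out 1?eq_sym // dfwith_in mulrCA; congr (_ * (_ * _)).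
by apply: eq_bigr => k /andP[kj ki]; rewrite !dfwith_out // eq_sym.
Qed.

(** Contract all slots except i and j with functionals that are nonzero on both
    tensors.  What remains is a tensor in V_i (x) V_j, and its four values at
    det(u, .) det(v, .), for u in {a_i, b_i} and v in {a_j, b_j}, form a 2 x 2
    matrix.  Purity of the sum makes its determinant vanish; but the matrix is
    diagonal, because det(a_i, a_i) = det(b_j, b_j) = 0, and its two diagonal
    entries are nonzero multiples of det(a_i, b_i) det(a_j, b_j). *)
Lemma pure_sum a b c i j : tens a != 0 -> tens b != 0 ->
  tens a + tens b = tens c -> i != j ->
  det i (a i) (b i) * det j (a j) (b j) = 0.
Proof.
move=> /tens_neq0P a0 /tens_neq0P b0 abc ij.
have [p pab] := common_dual a0 b0.
pose t (u : V i) (v : V j) := tens (dfwith (dfwith p u) v).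
pose R z := \prod_(k | (k != j) && (k != i)) det k (p k) (z k).
have tE u v z : bilin (t u v) (tens z) = det i u (z i) * (det j v (z j) * R z).
  exact: bilin_dfwith2.
have Bc u v : bilin (t u v) (tens c) = bilin (t u v) (tens a) + bilin (t u v) (tens b).
  by rewrite -abc bilinDr.
have minor : bilin (t (a i) (a j)) (tens c) * bilin (t (b i) (b j)) (tens c) =
    bilin (t (a i) (b j)) (tens c) * bilin (t (b i) (a j)) (tens c).
  by rewrite !tE; ring.
move: minor; rewrite !Bc !tE !pdetvv !(mul0r, mulr0, addr0, add0r) => /eqP.
have Ra : R a != 0 by apply/prodf_neq0 => k _; case/andP: (pab k).
have Rb : R b != 0 by apply/prodf_neq0 => k _; case/andP: (pab k).
rewrite !mulf_eq0 (negbTE Ra) (negbTE Rb) !orbF => /or3P.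
rewrite (pdetC _ (b i)) (pdetC _ (b j)) !oppr_eq0.
by case=> [/orP[]|/eqP|/eqP] h; rewrite ?(eqP h) ?h ?mul0r ?mulr0.
Qed.

(** Counting non-proportional instead of unequal slots makes the distance depend
    on the points of the Segre variety alone. *)
Definition hdist (a b : family) := #|[set k | det k (a k) (b k) != 0]|.

Lemma hdist_trans b a c : (forall k, b k != 0) ->
  (hdist a c <= hdist a b + hdist b c)%N.
Proof.
move=> b0; apply: leq_trans (leq_card_setU _ _).
apply/subset_leq_card/subsetP => k.
rewrite !inE -negb_and; apply: contra => /andP[/eqP ab /eqP bc].
by rewrite (pdet_trans (b0 k) ab bc).
Qed.

Lemma hdist_pure a b c : tens a != 0 -> tens b != 0 ->
  tens a + tens b = tens c -> (hdist a b <= 1)%N.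
Proof.
move=> a0 b0 abc; apply/card_le1P => i; rewrite inE => iab j.
rewrite !inE; apply/idP/eqP => [jab|-> //]; apply/eqP.
apply: contraNT jab => ij; have := pure_sum a0 b0 abc ij.
by move/eqP; rewrite mulf_eq0 [in X in _ || X -> _](negbTE iab) orbF.
Qed.

(** * Similitudes from collineations of the Segre variety *)

Definition flip (I : idx) (k : 'I_m) : idx := [ffun j => (j == k) (+) I j].

Lemma basis_flip I k : E (flip I k) = tens (dfwith (bfam V I) (bvec (V k) (~~ I k))).
Proof.
congr tens; apply: functional_extensionality_dep => j; rewrite /bfam ffunE.
by case: dfwithP => [|{}j kj]; [rewrite eqxx | rewrite eq_sym (negbTE kj)].
Qed.

(** The diagonal vector e_0 + e_1 in slot k: evaluating an alternating form at
    two families with this same entry compares its values at I and at [flip I k]. *)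
Definition diag_fam (I : idx) (k : 'I_m) : family :=
  dfwith (bfam V I) (bvec (V k) false + bvec (V k) true).

Lemma tens_diag I k : tens (diag_fam I k) = E I + E (flip I k).
Proof.
rewrite multilinearD // basis_flip.
rewrite -[E I](congr1 tens (dfwith_id (bfam V I) k)) /bfam.
by case: (I k) => //=; rewrite addrC.
Qed.

Lemma bfam_neq0 I k : bfam V I k != 0.
Proof. exact: bvec_neq0. Qed.

Lemma diag_fam_neq0 I k j : diag_fam I k j != 0.
Proof.
rewrite /diag_fam; case: dfwithP => [|{}j _]; last exact: bfam_neq0.
exact: bvecD_neq0.
Qed.

Lemma flip_compl I k : compl (flip I k) = flip (compl I) k.
Proof. by apply/ffunP => j; rewrite !ffunE addbN. Qed.

Lemma scalar_ext (f h : T -> F) : scalar f -> scalar h ->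
  (forall I, f (E I) = h (E I)) -> f =1 h.
Proof.
move=> lf lh fh X.
have [f' f'E] := @linear_bundle F T F^o f lf.
have [h' h'E] := @linear_bundle F T F^o h lh.
rewrite -f'E -h'E (xD X) !linear_sum; apply: eq_bigr => I _.
by rewrite !linearZ /= f'E h'E fh.
Qed.

(** Here [gam] chooses, for each family a, factors of the pure tensor g (tens a). *)
Section Collineation.
Variables (g : {linear T -> T}) (gam : family -> family).
Hypothesis g_surj : forall Y, exists X, g X = Y.
Hypothesis g_tens0 : forall a, tens a != 0 -> g (tens a) != 0.
Hypothesis gE : forall a, g (tens a) = tens (gam a).

(** Replacing a single entry a_k by b_k changes tens a to a tensor whose sum with
    tens a is again pure; by [hdist_pure] the images are at distance at most one.
    Moving from a to b entry by entry and adding up gives the bound. *)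
Lemma hdist_collineation a b : (forall k, a k != 0) -> (forall k, b k != 0) ->
  (hdist (gam a) (gam b) <= #|[set k | a k != b k]|)%N.
Proof.
move=> a0 b0; have [n] := ubnP #|[set k | a k != b k]|.
elim: n a a0 => // n IHn a a0 an.
case: (set_0Vmem [set k | a k != b k]) => [ab0|[k kab]].
  have -> : a = b.
    apply: functional_extensionality_dep => k; apply/eqP.
    by have := in_set0 k; rewrite -ab0 inE => /negbFE.
  rewrite (_ : hdist _ _ = 0%N) //; apply/eqP; rewrite cards_eq0; apply/eqP/setP => k.
  by rewrite !inE pdetvv eqxx.
pose a' := dfwith a (b k).
have a'0 j : a' j != 0 by rewrite /a'; case: dfwithP.
have a'b : [set j | a' j != b j] = [set j | a j != b j] :\ k.
  apply/setP => j; rewrite !inE /a'; case: dfwithP => [|{}j kj]; first by rewrite !eqxx.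
  by rewrite [j == k]eq_sym kj.
have gam0 c : (forall k, c k != 0) -> tens (gam c) != 0.
  by move=> c0; rewrite -gE g_tens0 // tens_neq0.
have cE : #|[set j | a j != b j]| = #|[set j | a' j != b j]|.+1.
  by rewrite a'b (cardsD1 k) kab.
rewrite cE -add1n; apply: leq_trans (hdist_trans _ _ (tens_neq0P (gam0 _ a'0))) _.
apply: leq_add; last by apply: IHn => //; rewrite -ltnS -cE.
apply: (@hdist_pure _ _ (gam (dfwith a (a k + b k)))); try exact: gam0.
by rewrite -!gE multilinearD // linearD dfwith_id.
Qed.

(** The images are at distance less than m, so some factors are proportional and
    the corresponding determinant vanishes. *)
Lemma bilin_agree a b k : (forall k, a k != 0) -> (forall k, b k != 0) ->
  a k = b k -> bilin (g (tens a)) (g (tens b)) = 0.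
Proof.
move=> a0 b0 ab; rewrite !gE bilin_tens.
have : (hdist (gam a) (gam b) < m)%N.
  apply: leq_ltn_trans (hdist_collineation a0 b0) _; rewrite -[X in (_ < X)%N]card_ord.
  rewrite -[X in (_ < X)%N]cardsT; apply/proper_card/properP.
  by split; [exact: subsetT | exists k; rewrite !inE ?ab ?eqxx].
move=> h; apply/eqP; apply: contraTT h => /prodf_neq0 d0; rewrite -leqNgt.
rewrite -[X in (X <= _)%N]card_ord -[X in (X <= _)%N]cardsT.
by apply/subset_leq_card/subsetP => j _; rewrite inE d0.
Qed.

(** Expand the vanishing value at two diagonal families that agree in slot k: the
    two mixed terms vanish too, since their arguments agree in slot k. *)
Lemma bilin_flip I k : bilin (g (E (flip I k))) (g (E (compl (flip I k)))) =
  bilin (g (E I)) (g (E (compl I))).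
Proof.
have := @bilin_agree (diag_fam I k) (diag_fam (compl I) k) k.
move/(_ (diag_fam_neq0 _ _) (diag_fam_neq0 _ _)).
rewrite /diag_fam !dfwith_in => /(_ erefl).
rewrite -!/(diag_fam _ _) !tens_diag !linearD bilinDl !bilinDr -flip_compl.
rewrite (@bilin_agree (bfam V I) (bfam V (compl (flip I k))) k); last first.
- by rewrite /bfam !ffunE eqxx /= negbK.
- by move=> j; exact: bfam_neq0.
- by move=> j; exact: bfam_neq0.
rewrite (@bilin_agree (bfam V (flip I k)) (bfam V (compl I)) k); last first.
- by rewrite /bfam !ffunE eqxx.
- by move=> j; exact: bfam_neq0.
- by move=> j; exact: bfam_neq0.
by rewrite addr0 add0r addrC => /eqP; rewrite addr_eq0 oppr_pchar2 // => /eqP.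
Qed.

Let I0 : idx := [ffun => false].
Let mu := bilin (g (E I0)) (g (E (compl I0))).

Lemma bilin_compl I : bilin (g (E I)) (g (E (compl I))) = mu.
Proof.
have [n] := ubnP #|[set k | I k]|; elim: n I => // n IHn I In.
case: (set_0Vmem [set k | I k]) => [Ik0|[k kI]].
  suff -> : I = I0 by [].
  by apply/ffunP => k; have := in_set0 k; rewrite -Ik0 inE ffunE.
rewrite -(bilin_flip I k); apply: IHn; rewrite -ltnS; apply: leq_trans In.
rewrite ltnS; apply/proper_card/properP; split.
  apply/subsetP => j; rewrite !inE ffunE; case: eqP => // ->.
  by move: kI; rewrite inE => ->.
by exists k => //; move: kI; rewrite !inE ffunE eqxx => ->.
Qed.

Lemma bilin_collineation X Y : bilin (g X) (g Y) = mu * bilin X Y.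
Proof.
apply: (@scalar_ext (fun X => bilin (g X) (g Y)) (fun X => mu * bilin X Y))
  => [a u v|a u v|I].
- by rewrite linearP bilin_linearl.
- by rewrite bilin_linearl mulrDr mulrCA.
apply: (@scalar_ext (fun Y => bilin (g (E I)) (g Y)) (fun Y => mu * bilin (E I) Y))
  => [a u v|a u v|J].
- by rewrite linearP bilin_linearr.
- by rewrite bilin_linearr mulrDr mulrCA.
rewrite bilin_basis coord_basis; have [<-|IJ] := eqVneq.
  by rewrite bilin_compl mulr1.
have [k kIJ] := ffun_neq_ex IJ.
rewrite mulr0; apply: (@bilin_agree _ _ k); try exact: bfam_neq0.
by rewrite /bfam; congr bvec; move: kIJ; rewrite ffunE; case: (I k); case: (J k).
Qed.

Lemma multiplier_neq0 : mu != 0.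
Proof.
have [X gX] := g_surj (E I0); have [Y gY] := g_surj (E (compl I0)).
have := bilin_collineation X Y; rewrite gX gY bilin_basis coord_basis eqxx.
by apply: contra_eq_neq => ->; rewrite mul0r oner_eq0.
Qed.

(** The difference D of the two forms has zero polar form, so it is additive and
    satisfies D(a Y) = a^2 D(Y); it vanishes because it does so on the basis E. *)
Lemma quad_collineation X : quad (g X) = mu * quad X.
Proof.
pose D X := quad (g X) - mu * quad X.
have QD Y Z : quad (Y + Z) = quad Y + quad Z + bilin Y Z.
  by rewrite -polar_quad /polar; ring.
have [QZ _] := quad_quadratic.
have DD : {morph D : Y Z / Y + Z}.
  by move=> Y Z; rewrite /D linearD !QD bilin_collineation; ring.
have DZ a Y : D (a *: Y) = a ^+ 2 * D Y by rewrite /D linearZ /= !QZ; ring.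
have D0 : D 0 = 0 by rewrite -(scale0r 0) DZ expr0n mul0r.
apply/eqP; rewrite -subr_eq0 -/(D X) (xD X) (big_morph D DD D0).
by rewrite big1 // => I _; rewrite DZ /D gE !quad_tens mulr0 subr0 mulr0.
Qed.

Lemma similitude : exists2 c : F, c != 0 & forall X, quad (g X) = c * quad X.
Proof. by exists mu; [exact: multiplier_neq0 | exact: quad_collineation]. Qed.

End Collineation.

End Form.

(** * Quadrics as sets of points *)

Section Projective.
Variables (F : fieldType) (T : vectType F).

Definition line_point (X : T) (X0 : X != 0) : proj_point T :=
  exist _ <[X]>%VS (introT eqP (etrans (dim_vline X) (congr1 nat_of_bool X0))).

Lemma proj_point_gen (P : proj_point T) : exists2 X : T, X != 0 & \val P = <[X]>%VS.
Proof.
case: P => U /= /eqP U1; exists (vpick U).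
  by rewrite vpick0 -dimv_eq0 U1.
apply/eqP; rewrite eq_sym eqEdim -memvE memv_pick dim_vline vpick0 -dimv_eq0 U1.
by [].
Qed.

(** The zero set of a quadratic form is stable under scaling, so the vector that
    represents a point of the quadric may be chosen freely. *)
Lemma quadric_line (Q : T -> F) (P : proj_point T) (X : T) :
  quadratic_form Q -> X != 0 -> \val P = <[X]>%VS -> quadric Q P <-> Q X = 0.
Proof.
move=> [QZ _] X0 PX; split=> [[Y [_ [PY QY]]]|QX]; last by exists X.
have /vlineP[a ->] : X \in <[Y]>%VS by rewrite -PY PX memv_line.
by rewrite QZ QY mulr0.
Qed.

Lemma quadric_contained (Q : T -> F) (U : {vspace T}) : quadratic_form Q ->
  contained U (quadric Q) <-> forall X, X \in U -> Q X = 0.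
Proof.
move=> qQ; split=> [UQ X XU|UQ P PU].
  have [->|X0] := eqVneq X 0; first by rewrite -(scale0r 0) qQ.1 expr0n mul0r.
  apply/(@quadric_line Q (line_point X0) X) => //; apply: UQ.
  by rewrite /= -memvE.
have [X X0 PX] := proj_point_gen P.
by apply/(quadric_line qQ X0 PX)/UQ; rewrite memvE -PX.
Qed.

Lemma similitude_stabilises (Q : T -> F) (phi : proj_point T -> proj_point T)
    (g : 'End(T)) (c : F) :
  quadratic_form Q -> lker g = 0%VS -> (forall P, \val (phi P) = (g @: \val P)%VS) ->
  c != 0 -> (forall X, Q (g X) = c * Q X) -> stabilises phi (quadric Q).
Proof.
move=> qQ /eqP g0 phiE c0 Qg.
have gP P X : X != 0 -> \val P = <[X]>%VS -> g X != 0 /\ \val (phi P) = <[g X]>%VS.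
  move=> X0 PX; rewrite phiE PX limg_line; split=> //.
  by rewrite -(linear0 g) (inj_eq (lker0P g0)).
apply/seteqP; split=> [_ [P QP <-]|P QP].
  have [X X0 PX] := proj_point_gen P; have [gX0 phiP] := gP _ _ X0 PX.
  apply/(quadric_line qQ gX0 phiP).
  by rewrite Qg ((quadric_line qQ X0 PX).1 QP) mulr0.
have [Y Y0 PY] := proj_point_gen P.
pose X := (g^-1)%VF Y; have gX : g X = Y by rewrite /X lker0_lfunVK.
have X0 : X != 0 by apply: contraNneq Y0 => X0; rewrite -gX X0 linear0.
exists (line_point X0); last first.
  by apply: val_inj; rewrite phiE /= limg_line gX PY.
apply/(@quadric_line Q (line_point X0) X) => //.
by apply: (mulfI c0); rewrite -Qg gX mulr0; apply/(quadric_line qQ Y0 PY).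
Qed.

End Projective.

(** Families with a zero entry are sent to zero by the tensor product, so a
    statement about points of the Segre variety covers all pure tensors. *)
Lemma segre_pure (F : fieldType) (m : nat) (V : 'I_m -> vectType F)
    (T : vectType F) (tens : (forall k, V k) -> T) (phi : proj_point T -> proj_point T)
    (g : 'End(T)) (k0 : 'I_m) :
  multilinear (V := fun k => V k) tens ->
  (forall a, (forall k, a k != 0) -> tens a != 0) ->
  (forall P, \val (phi P) = (g @: \val P)%VS) -> stabilises phi (segre tens) ->
  forall a, exists b, g (tens a) = tens b.
Proof.
move=> tml t0 phiE phiS a.
have [a0|] := boolP [forall k, a k != 0]; last first.
  rewrite negb_forall => /existsP[k /negPn/eqP ak]; exists a.
  by rewrite (multilinear_eq0 tml ak) linear0.
have {}a0 k : a k != 0 by exact: (forallP a0).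
have S : segre tens (phi (line_point (t0 a a0))).
  by rewrite -phiS; exists (line_point (t0 a a0)) => //; exists a.
case: S => b [_]; rewrite phiE /= limg_line => gb.
have /vlineP[l ->] : g (tens a) \in <[tens b]>%VS by rewrite -gb memv_line.
(* The scalar left over by the projective condition goes into slot k0. *)
by exists (dfwith b (l *: b k0)); rewrite multilinearZ.
Qed.

Theorem theorem1 (m : nat) (hm : (2 <= m)%N) (F : fieldType)
    (hF : 2%N \in [pchar F])
    (V : 'I_m -> vectType F) (hV : forall k : 'I_m, \dim {: V k} = 2%N)
    (T : vectType F) (tens : (forall k : 'I_m, V k) -> T)
    (hT : is_tensor_product tens) :
  exists Q : T -> F,
    quadratic_form Q /\ regular Q /\
    has_projective_index (quadric Q) ((2 ^ (m - 1))%N%:Z - 1) /\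
    (forall phi : proj_point T -> proj_point T,
       projective_collineation phi ->
       stabilises phi (segre tens) ->
       stabilises phi (quadric Q)).
Proof.
have [x [xE xD]] := tensor_coordinates hV hT.
have tml := hT.1.
have qQ : quadratic_form (quad hm x) by exact: quad_quadratic.
exists (quad hm x); split=> //; split; first exact: (quad_regular xE xD).
rewrite subn1; split.
  split.
    have [U [dU UQ]] := quad_singular_half hm xE.
    by exists U; split; [exact/quadric_contained | rewrite /projdim dU].
  move=> U /(quadric_contained _ qQ) UQ.
  by rewrite /projdim Num.Theory.lerD2r lez_nat; apply: quad_singular_le UQ.
move=> phi [g [g0 phiE]] phiS.
have t0 := tens_neq0 hF xE.
have pure := segre_pure (Ordinal (ltnW hm)) tml t0 phiE phiS.
have [gam gE] := choice pure.
have g_inj : injective g by apply/lker0P/eqP.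
have g_surj Y : exists X, g X = Y.
  by exists ((g^-1)%VF Y); rewrite lker0_lfunVK //; apply/eqP.
have g_tens0 a : tens a != 0 -> g (tens a) != 0.
  by move=> a0; rewrite -(linear0 g) (inj_eq g_inj).
have [c c0 Qg] := similitude hm hF tml xE xD g_surj g_tens0 gE.
exact: similitude_stabilises qQ g0 phiE c0 Qg.
Qed.
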